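(* Let $f:\mathbb R^n\to\mathbb R^n$ be continuously differentiable with $f(0)=0$ and $f(x)\ne0$ for all $x\ne0$, and such that $\dot x=f(x)$ has a unique solution for all $t\ge0$ for each $x(0)\in\mathbb R^n$. Let $0<p<1$ and $q<0$. Assume that $\lim_{x\to\infty}\|f(x)\|=\infty$ (i.e. as $\|x\|\to\infty$) and that either of the following conditions holds for the matrix function $H:\mathbb R^n\to\mathbb R^{n\times n}$ defined as $H(x)=-\left(\nabla f(x)+\nabla f(x)^T\right)$: (i) the matrix $H(x)$ is positive definite with its minimum eigenvalue $\lambda_0>0$ for all $x\ne0$; or (ii) the matrix $H(x)$ is positive semidefinite for all $x\in\mathbb R^n\setminus\{0\}$, the multiplicity of the eigenvalue $0$ is constant over $\mathbb R^n$, for all $x\in\mathbb R^n$ the vector $f(x)$ is orthogonal to the eigenspace of $H(x)$ corresponding to the eigenvalue $0$, and the second smallest eigenvalue of $H$ is positive for all $x\in\mathbb R^n$, i.e., there exists $\lambda_0>0$ such that $\inf_x\lambda_2(H(x))=\lambda_0$. Then the origin is globally asymptotically stable for $\dot x=f(x)$, and the origin is fixed-time stable for the system $$\dot x=\begin{cases}\left(\dfrac{1}{\|f(x)\|^{p}}+\dfrac{1}{\|f(x)\|^{q}}\right)f(x), & x\ne0,\\ 0, & x=0.\end{cases}$$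
   Context: $\|\cdot\|$ is the Euclidean norm, $\nabla f$ is the Jacobian matrix of $f$, and $\lambda_2(H(x))$ denotes the second smallest eigenvalue of $H(x)$. Stability notions for an equilibrium $x=0$ of a system with solutions $x(\cdot)$: - Lyapunov stable: for every $\epsilon>0$ there is $\delta(\epsilon)>0$ such that $\|x(0)\|<\delta\Rightarrow\|x(t)\|<\epsilon$ for all $t\ge0$. - Globally asymptotically stable: Lyapunov stable and $\|x(t)\|\to0$ as $t\to\infty$ for all $x(0)\in\mathbb R^n$. - Finite-time stable: Lyapunov stable and there exists a settling-time function $T:\mathbb R^n\to\mathbb R_+$ such that $T(x(0))<\infty$ for all $x(0)\in\mathbb R^n$ and $x(t)\to0$ as $t\to T(x(0))$. - Fixed-time stable: finite-time stable and the settling-time function is bounded over all $x(0)\in\mathbb R^n$. *)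

(* Defs.v *)
From mathcomp Require Import all_boot all_order all_algebra.
From mathcomp Require Import all_classical all_reals all_analysis.

Set Implicit Arguments.
Unset Strict Implicit.
Unset Printing Implicit Defensive.

Import Order.TTheory GRing.Theory Num.Theory.
Import numFieldNormedType.Exports.

Local Open Scope classical_set_scope.
Local Open Scope ring_scope.

(* The library norm `|x| on 'rV[R]_n is the sup norm. *)
Definition enorm (R : realType) (n : nat) (x : 'rV[R]_n) : R :=
  Num.sqrt (\sum_(i < n) x ord0 i ^+ 2).

Definition C1 (R : realType) (n : nat) (f : 'rV[R]_n -> 'rV[R]_n) : Prop :=
  (forall x, differentiable f x) /\ continuous (jacobian f).

(* [jacobian f x] acts on row vectors from the right, so it is the transpose of
   the usual Jacobian matrix; H is unaffected. *)
Definition Hmx (R : realType) (n : nat) (f : 'rV[R]_n -> 'rV[R]_n)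
    (x : 'rV[R]_n) : 'M[R]_n :=
  - (jacobian f x + (jacobian f x)^T).

Definition posdefmx (R : realType) (n : nat) (A : 'M[R]_n) : Prop :=
  forall v : 'rV[R]_n, v != 0 -> 0 < (v *m A *m v^T) ord0 ord0.

Definition possemidefmx (R : realType) (n : nat) (A : 'M[R]_n) : Prop :=
  forall v : 'rV[R]_n, 0 <= (v *m A *m v^T) ord0 ord0.

(* Both are used for symmetric A only, whose eigenvalues are all real. *)
Definition lambda_min (R : realType) (n : nat) (A : 'M[R]_n) : R :=
  inf [set a : R | eigenvalue A a].

(* Second smallest among the distinct eigenvalues: the multiplicity of the
   smallest one is arbitrary.  When A has a single eigenvalue this is the junk
   value [inf set0 = 0]. *)
Definition lambda2 (R : realType) (n : nat) (A : 'M[R]_n) : R :=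
  inf [set a : R | eigenvalue A a /\ lambda_min A < a].

(* Values of x at negative times are irrelevant; at t = 0 only continuity from
   the right is required. *)
Definition is_solution (R : realType) (n : nat) (g : 'rV[R]_n -> 'rV[R]_n)
    (x : R -> 'rV[R]_n) : Prop :=
  {within [set t : R | 0 <= t], continuous x} /\
  (forall t : R, 0 < t -> is_derive t 1 x (g (x t))).

Definition forward_complete (R : realType) (n : nat)
    (g : 'rV[R]_n -> 'rV[R]_n) : Prop :=
  forall x0, exists x, is_solution g x /\ x 0 = x0.

Definition forward_unique (R : realType) (n : nat)
    (g : 'rV[R]_n -> 'rV[R]_n) : Prop :=
  forall x y, is_solution g x -> is_solution g y -> x 0 = y 0 ->
  forall t : R, 0 <= t -> x t = y t.

Definition lyapunov_stable (R : realType) (n : nat)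
    (g : 'rV[R]_n -> 'rV[R]_n) : Prop :=
  forall e : R, 0 < e -> exists2 d : R, 0 < d &
    forall x, is_solution g x -> enorm (x 0) < d ->
    forall t : R, 0 <= t -> enorm (x t) < e.

(* The global notions below speak of the trajectory from every initial state,
   so [forward_complete] is part of them; without it a system having no
   solution on [0, +oo[ would be stable vacuously. *)
Definition globally_asymptotically_stable (R : realType) (n : nat)
    (g : 'rV[R]_n -> 'rV[R]_n) : Prop :=
  [/\ forward_complete g, lyapunov_stable g &
      forall x, is_solution g x -> enorm (x t) @[t --> +oo] --> (0 : R)].

(* The limit is taken within [0, +oo[, which matters only when T (x 0) = 0. *)
Definition settling_time (R : realType) (n : nat)
    (g : 'rV[R]_n -> 'rV[R]_n) (T : 'rV[R]_n -> R) : Prop :=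
  (forall x0, 0 <= T x0) /\
  (forall x, is_solution g x ->
     x t @[t --> within [set t : R | 0 <= t] (nbhs (T (x 0)))]
       --> (0 : 'rV[R]_n)).

Definition finite_time_stable (R : realType) (n : nat)
    (g : 'rV[R]_n -> 'rV[R]_n) : Prop :=
  [/\ forward_complete g, lyapunov_stable g & exists T, settling_time g T].

Definition fixed_time_stable (R : realType) (n : nat)
    (g : 'rV[R]_n -> 'rV[R]_n) : Prop :=
  finite_time_stable g /\
  exists2 T, settling_time g T & exists Tmax : R, forall x0, T x0 <= Tmax.

Definition fxts_field (R : realType) (n : nat) (p q : R)
    (f : 'rV[R]_n -> 'rV[R]_n) (x : 'rV[R]_n) : 'rV[R]_n :=
  if x == 0 then 0
  else ((enorm (f x) `^ p)^-1 + (enorm (f x) `^ q)^-1) *: f x.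

Definition condition_i (R : realType) (n : nat)
    (f : 'rV[R]_n -> 'rV[R]_n) : Prop :=
  exists2 lambda0 : R, 0 < lambda0 &
    forall x, x != 0 -> posdefmx (Hmx f x) /\ lambda0 <= lambda_min (Hmx f x).

(* 0 is an eigenvalue of every H(x), hence the positive multiplicity. *)
Definition condition_ii (R : realType) (n : nat)
    (f : 'rV[R]_n -> 'rV[R]_n) : Prop :=
  [/\ forall x, x != 0 -> possemidefmx (Hmx f x),
      exists2 k : nat, (0 < k)%N &
        forall x, mup 0 (char_poly (Hmx f x)) = k,
      forall x v : 'rV[R]_n, (v <= eigenspace (Hmx f x) 0)%MS ->
        f x *m v^T = 0 &
      exists2 lambda0 : R, 0 < lambda0 &
        inf (range (fun x => lambda2 (Hmx f x))) = lambda0].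

(* Main.v *)
Require Import Defs.
From mathcomp Require Import all_boot all_order all_algebra.
From mathcomp Require Import all_classical all_reals all_analysis.
From mathcomp Require Import ring lra.

Set Implicit Arguments.
Unset Strict Implicit.
Unset Printing Implicit Defensive.

Import Order.TTheory GRing.Theory Num.Theory.
Import numFieldNormedType.Exports.

Local Open Scope classical_set_scope.
Local Open Scope ring_scope.

(** Everything rests on the energy [W(x) = |f(x)|^2] and on one inequality,
    [l * W(x) <= f(x) H(x) f(x)^T] for a fixed [l > 0] ([dissipation]).  Under
    the first condition it is the Rayleigh bound for the smallest eigenvalue.
    Under the second one [f(x)] is orthogonal to the kernel of [H(x)], and on
    that orthogonal complement the Rayleigh quotient is at least the smallest
    nonzero eigenvalue.  Both cases are instances of
    [symmetric_quadratic_form_ge].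

    Along a solution [y] of [y' = c(y) f(y)] with [c >= 0] the chain rule gives
    [W(y)' = - c(y) f(y) H(y) f(y)^T <= - c(y) l W(y)], so [W] never increases.
    Since [f] vanishes only at the origin and is coercive, small energy means
    small state ([energy_proper]), whence Lyapunov stability of every field
    [c f] ([descent_lyapunov_stable]).  For [c = 1] the energy decays like
    [exp(- l t)], whence global attraction ([descent_attractive]).

    For the rescaled field, [c = u^(-p) + u^(-q)] with [u = |f| = W^(1/2)], so
    [c W^(r/2) >= 1] both for [r = p] and for [r = q].  Therefore
    [(2/r) W(y)^(r/2)] decreases at rate at least [l] as long as [W(y) > 0]
    ([power_energy_decrease]).  With [r = q < 0] this brings [W] down to [1]
    within time [2/(-q l)] whatever the initial state, and with [r = p > 0] it
    brings [W] from [1] to [0] within a further time [2/(p l)] ([settles]).  The sum of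
    these two times is a settling time valid for all initial states.

    It remains to see that the rescaled system, whose right-hand side need
    not be Lipschitz at the origin, has solutions for all time
    ([fxts_field_forward_complete]).  They are obtained from a solution [x] of
    [x' = f(x)] by the change of time [s' = 1 / c(x)] ([time_change]).  The
    solution [x] stays away from the origin ([never_reaches_zero]), so [s] is
    a strictly increasing C1 function, and the same power-of-energy estimate
    with [r = p] shows that it has a finite limit [S].  The curve [x] composed
    with the inverse of [s] solves the rescaled system before time [S]; extended
    by [0] from [S] on, it is still differentiable at [S] because the rescaled
    field tends to [0] at the origin. *)

(** * The Euclidean inner product and quadratic forms *)

Definition dot (R : realType) (n : nat) (u v : 'rV[R]_n) : R :=
  (u *m v^T) ord0 ord0.

Section Dot.
Context {R : realType} {n : nat}.
Implicit Types u v w : 'rV[R]_n.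

Lemma dotE u v : dot u v = \sum_i u ord0 i * v ord0 i.
Proof. by rewrite /dot mxE; apply: eq_bigr => i _; rewrite mxE. Qed.

Lemma dotC u v : dot u v = dot v u.
Proof. by rewrite !dotE; apply: eq_bigr => i _; rewrite mulrC. Qed.

Lemma dotDl u v w : dot (u + v) w = dot u w + dot v w.
Proof. by rewrite /dot mulmxDl mxE. Qed.

Lemma dotDr u v w : dot w (u + v) = dot w u + dot w v.
Proof. by rewrite dotC dotDl !(dotC w). Qed.

Lemma dotZl a u w : dot (a *: u) w = a * dot u w.
Proof. by rewrite /dot -scalemxAl mxE. Qed.

Lemma dotZr a u w : dot w (a *: u) = a * dot w u.
Proof. by rewrite dotC dotZl dotC. Qed.

Lemma dotNl u w : dot (- u) w = - dot u w.
Proof. by rewrite /dot mulNmx mxE. Qed.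

Lemma dot_mulmxl u v (A : 'M[R]_n) : dot (u *m A) v = dot u (v *m A^T).
Proof. by rewrite /dot trmx_mul trmxK mulmxA. Qed.

Lemma dot_ge0 u : 0 <= dot u u.
Proof. by rewrite dotE; apply: sumr_ge0 => i _; rewrite -expr2 sqr_ge0. Qed.

Lemma dot_eq0 u : (dot u u == 0) = (u == 0).
Proof.
apply/idP/eqP => [|->]; last by rewrite /dot mul0mx mxE.
rewrite dotE psumr_eq0; last by move=> i _; rewrite -expr2 sqr_ge0.
move=> /allP u0; apply/rowP => i; rewrite mxE.
by have := u0 i (mem_index_enum _); rewrite mulf_eq0 orbb => /eqP.
Qed.

Lemma dot_gt0 u : u != 0 -> 0 < dot u u.
Proof. by move=> u0; rewrite lt_def dot_eq0 u0 dot_ge0. Qed.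

Lemma sqr_coord_le_dot u i : u ord0 i ^+ 2 <= dot u u.
Proof.
rewrite dotE (bigD1 i)//= -expr2 lerDl.
by apply: sumr_ge0 => j _; rewrite -expr2 sqr_ge0.
Qed.

Lemma norm_entry_le m (A : 'M[R]_(m, n)) i j : `|A i j| <= `|A|.
Proof.
rewrite [leRHS]/Num.Def.normr/= mx_normrE.
exact: (le_bigmax _ (fun k : 'I_m * 'I_n => `|A k.1 k.2|) (i, j)).
Qed.

Lemma norm_le_coord u c : 0 <= c -> (forall i, `|u ord0 i| <= c) -> `|u| <= c.
Proof.
move=> c0 uc; rewrite [leLHS]/Num.Def.normr/= mx_normrE bigmax_le// => -[i j] _.
by rewrite /= (ord1 i).
Qed.

Lemma sqr_norm_le_dot u : `|u| ^+ 2 <= dot u u.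
Proof.
rewrite -[leRHS]sqr_sqrtr ?dot_ge0// ler_sqr ?nnegrE ?sqrtr_ge0//.
apply: norm_le_coord => [|i]; first exact: sqrtr_ge0.
by rewrite -sqrtr_sqr ler_sqrt ?dot_ge0// sqr_coord_le_dot.
Qed.

(** A crude bound through the sup norms of [A] and [u]; only its linearity in
    [dot u u] matters, to compare the energy with an exponential from below. *)
Lemma quadratic_form_le (A : 'M[R]_n) u :
  dot (u *m A) u <= n%:R ^+ 2 * `|A| * dot u u.
Proof.
apply: (@le_trans _ _ (n%:R ^+ 2 * `|A| * `|u| ^+ 2)); last first.
  by rewrite ler_wpM2l ?sqr_norm_le_dot// mulr_ge0// exprn_ge0.
rewrite dotE; apply: (@le_trans _ _ (\sum_(i < n) n%:R * (`|A| * `|u| ^+ 2))).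
  apply: ler_sum => i _; rewrite mxE mulr_suml.
  apply: (@le_trans _ _ (\sum_(j < n) `|A| * `|u| ^+ 2)).
    apply: ler_sum => j _; apply: le_trans (ler_norm _) _.
    rewrite !normrM -mulrA mulrCA expr2.
    by rewrite ler_pM ?ler_pM ?mulr_ge0 ?norm_entry_le.
  by rewrite sumr_const card_ord mulr_natl.
by rewrite sumr_const card_ord -[leLHS]mulr_natl expr2 !mulrA.
Qed.

End Dot.

Section Convergence.
Context {R : realType} {T : Type} {F : set_system T} {FF : Filter F} {n : nat}.
Implicit Types g h : T -> 'rV[R]_n.

Lemma cvg_coord g (u : 'rV[R]_n) i :
  g @ F --> u -> g x ord0 i @[x --> F] --> u ord0 i.
Proof.
move=> gu; apply: (@cvg_comp _ _ _ g (fun M : 'rV[R]_n => M ord0 i)) gu _.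
exact: coord_continuous.
Qed.

Lemma cvg_row g (u : 'rV[R]_n) :
  (forall i, g x ord0 i @[x --> F] --> u ord0 i) -> g @ F --> u.
Proof.
move=> gu; apply/cvgrPdist_le => e e0.
near=> x; apply: norm_le_coord => [|i]; first exact: ltW.
rewrite !mxE; move: i; near: x; apply: filter_forall => i.
by move/cvgrPdist_le : (gu i); exact.
Unshelve. all: by end_near. Qed.

Lemma cvg_dot g h (u v : 'rV[R]_n) : g @ F --> u -> h @ F --> v ->
  dot (g x) (h x) @[x --> F] --> dot u v.
Proof.
move=> gu hv; rewrite dotE; under eq_fun do rewrite dotE.
apply: cvg_big => [|i _]; first exact: add_continuous.
by apply: cvgM; exact: cvg_coord.
Qed.

Lemma cvg_mulmxr g (u : 'rV[R]_n) (A : 'M[R]_n) :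
  g @ F --> u -> g x *m A @[x --> F] --> u *m A.
Proof.
move=> gu; apply: cvg_row => i; rewrite mxE; under eq_fun do rewrite mxE.
apply: cvg_big => [|j _]; first exact: add_continuous.
by apply: cvgM; [exact: cvg_coord|exact: cvg_cst].
Qed.

End Convergence.

(** The Rayleigh quotient of [A] attains its minimum [m] on the compact set of
    unit vectors orthogonal to the kernel of [A].  As [A] is symmetric it
    preserves the orthogonal complement of its kernel, so the first variation
    at a minimiser [w] forces [w A = m w].  The eigenvalue [m] is nonzero, since
    otherwise [w] would be orthogonal to itself; hence [l <= m]. *)
Lemma symmetric_quadratic_form_ge (R : realType) (n : nat) (A : 'M[R]_n)
    (l : R) (v : 'rV[R]_n) :
  A^T = A -> (forall a, eigenvalue A a -> a != 0 -> l <= a) ->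
  (forall u, u *m A = 0 -> dot v u = 0) ->
  l * dot v v <= dot (v *m A) v.
Proof.
move=> symA lA vA.
have [->|v0] := eqVneq v 0; first by rewrite mul0mx /dot mul0mx mxE mulr0.
pose P := [set w : 'rV[R]_n | forall u, u *m A = 0 -> dot w u = 0].
pose K := P `&` [set w | dot w w = 1].
have PD u w : P u -> P w -> P (u + w).
  by move=> Pu Pw z z0; rewrite dotDl Pu// Pw// addr0.
have PZ a u : P u -> P (a *: u).
  by move=> Pu z z0; rewrite dotZl Pu// mulr0.
have PA u : P (u *m A).
  by move=> z z0; rewrite dot_mulmxl symA z0 /dot trmx0 mulmx0 mxE.
have normalized u : P u -> u != 0 -> K ((Num.sqrt (dot u u))^-1 *: u).
  move=> Pu u0; split; first exact: PZ.
  rewrite /= dotZl dotZr mulrA -expr2 exprVn sqr_sqrtr ?dot_ge0//.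
  by rewrite mulVf// dot_eq0.
have K0 : K !=set0 by eexists; apply: (normalized v).
have compactK : compact K.
  apply: bounded_closed_compact.
    exists 1; split => // M M1 w [_ /= w1].
    rewrite (le_trans _ (ltW M1))// -[leRHS]ger0_norm// -ler_sqr ?nnegrE//.
    by rewrite ger0_norm// expr1n -w1 sqr_norm_le_dot.
  apply: closedI.
    rewrite (_ : P = \bigcap_(u in [set u | u *m A = 0])
      [set w | dot w u = 0])//.
    apply: closed_bigI => u _.
    apply: (@preimage_closed _ _ (fun w => dot w u) [set 0]);
      last exact: closed_eq.
    move=> w _; apply: (@cvg_dot _ _ (nbhs w)); [exact: cvg_id|exact: cvg_cst].
  apply: (@preimage_closed _ _ (fun w => dot w w) [set 1]);
      last exact: closed_eq.
  by move=> w _; apply: (@cvg_dot _ _ (nbhs w)); exact: cvg_id.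
pose Q (w : 'rV[R]_n) := dot (w *m A) w.
have QZ a u : Q (a *: u) = a ^+ 2 * Q u.
  by rewrite /Q -scalemxAl dotZl dotZr mulrA.
have cQ : {within K, continuous Q}.
  apply: continuous_subspaceT => w; apply: (@cvg_dot _ _ (nbhs w));
    last exact: cvg_id.
  by apply: (@cvg_mulmxr _ _ (nbhs w)); exact: cvg_id.
have [w wK minQ] := EVT_min_rV K0 compactK cQ.
move: wK; rewrite inE => -[Pw /= w1].
set m := Q w in minQ.
have Qge u : P u -> m * dot u u <= Q u.
  move=> Pu; have [->|u0] := eqVneq u 0.
    by rewrite /Q mul0mx /dot mul0mx mxE mulr0.
  have := minQ _ (mem_set (normalized u Pu u0)).
  rewrite QZ exprVn sqr_sqrtr ?dot_ge0// mulrC.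
  by rewrite ler_pdivlMr// dot_gt0.
(* First variation of the Rayleigh quotient at [w] along the residue [d]. *)
have [d dE] : exists d, d = w *m A - m *: w by eexists.
have Pd : P d by rewrite dE; apply: PD => //; rewrite -scaleNr; exact: PZ.
have dd : dot (w *m A) d - m * dot w d = dot d d.
  transitivity (dot (w *m A - m *: w) d); last by rewrite -dE.
  by rewrite dotDl dotNl dotZl.
have Qd t : 0 <= 2 * t * dot d d + t ^+ 2 * (Q d - m * dot d d).
  have := Qge _ (PD _ _ Pw (PZ t _ Pd)).
  have dA : dot (d *m A) w = dot (w *m A) d by rewrite dot_mulmxl symA dotC.
  rewrite /Q mulmxDl -scalemxAl !dotDl !dotDr !dotZl !dotZr dA w1 (dotC d w).
  rewrite -/(Q w) -/m -/(Q d) -dd; nra.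
(* If [d] were nonzero, the step [t = - |d|^2 / (B + 1)] would make the
   quadratic polynomial of [Qd] negative. *)
have d0 : d = 0.
  apply/eqP; rewrite -dot_eq0; apply/negPn/negP => dN0.
  have D0 : 0 < dot d d by rewrite lt_def dN0 dot_ge0.
  have B0 : 0 <= Q d - m * dot d d by rewrite subr_ge0 Qge.
  move: B0 D0 Qd; set B := Q d - _; set D := dot d d => B0 D0 Qd.
  have B1 : 0 < B + 1 by lra.
  have := Qd (- D / (B + 1)).
  rewrite (_ : _ + _ = - (D ^+ 2 * (B + 2) / (B + 1) ^+ 2)); last first.
    by field; rewrite gt_eqF.
  apply/negP; rewrite -ltNge oppr_lt0 divr_gt0// ?exprn_gt0//.
  by rewrite mulr_gt0 ?exprn_gt0//; lra.
have wA : w *m A = m *: w by apply/eqP; rewrite -subr_eq0 -dE d0.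
have w0 : w != 0 by rewrite -dot_eq0 w1 oner_eq0.
have m0 : m != 0.
  apply/negP => /eqP m0; move: (w1); rewrite Pw ?wA ?m0 ?scale0r// => /eqP.
  by rewrite eq_sym oner_eq0.
have lm : l <= m by apply: lA => //; apply/eigenvalueP; exists w.
by apply: le_trans (Qge v vA); rewrite ler_wpM2r ?dot_ge0.
Qed.

(** * Dissipation from the two spectral conditions *)

Lemma eigenvalue_ge0 (R : realType) (n : nat) (A : 'M[R]_n) a :
  possemidefmx A -> eigenvalue A a -> 0 <= a.
Proof.
move=> psdA /eigenvalueP[u uA u0].
have := psdA u; rewrite -/(dot (u *m A) u) uA dotZl.
by rewrite pmulr_lge0// dot_gt0.
Qed.

Lemma posdefmx_possemidef (R : realType) (n : nat) (A : 'M[R]_n) :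
  posdefmx A -> possemidefmx A.
Proof.
move=> pdA u; have [->|/pdA/ltW//] := eqVneq u 0.
by rewrite !mul0mx mxE.
Qed.

(** Semidefiniteness makes the spectrum bounded below: the infimum of a set
    without lower bound is the default value [0]. *)
Lemma lambda_min_le (R : realType) (n : nat) (A : 'M[R]_n) a :
  possemidefmx A -> eigenvalue A a -> lambda_min A <= a.
Proof.
move=> psdA Aa; apply: ge_inf => //.
by exists 0 => b /=; exact: eigenvalue_ge0.
Qed.

Lemma lambda2_le (R : realType) (n : nat) (A : 'M[R]_n) a :
  possemidefmx A -> eigenvalue A 0 -> eigenvalue A a -> a != 0 ->
  lambda2 A <= a.
Proof.
move=> psdA A0 Aa a0; apply: ge_inf.
  by exists 0 => b /= [] /(eigenvalue_ge0 psdA).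
split=> //; apply: le_lt_trans (lambda_min_le psdA A0) _.
by rewrite lt_def a0 (eigenvalue_ge0 psdA).
Qed.

Lemma Hmx_sym (R : realType) (n : nat) (f : 'rV[R]_n -> 'rV[R]_n) x :
  (Hmx f x)^T = Hmx f x.
Proof. by rewrite /Hmx linearN/= linearD/= trmxK addrC. Qed.

(** Both conditions are reduced to the same two facts: the nonzero eigenvalues
    of [H(x)] are at least [l], and [f(x)] is orthogonal to the kernel of
    [H(x)].  Positive definiteness makes the kernel trivial.  In the
    semidefinite case the positive multiplicity makes [0] an eigenvalue, hence
    the least one, so that every nonzero eigenvalue is at least the second
    smallest; the positive infimum is a genuine lower bound, because an
    unbounded set would have infimum [0]. *)
Lemma dissipation (R : realType) (n : nat) (f : 'rV[R]_n -> 'rV[R]_n) :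
  f 0 = 0 -> condition_i f \/ condition_ii f ->
  exists2 l : R, 0 < l &
    forall x, l * dot (f x) (f x) <= dot (f x *m Hmx f x) (f x).
Proof.
move=> f0 cond.
suff [l l0 lP] : exists2 l : R, 0 < l & forall x, x != 0 ->
    (forall a, eigenvalue (Hmx f x) a -> a != 0 -> l <= a) /\
    (forall u, u *m Hmx f x = 0 -> dot (f x) u = 0).
  exists l => // x; have [->|/lP[la fu]] := eqVneq x 0.
    by rewrite f0 mul0mx /dot mul0mx mxE mulr0.
  by apply: symmetric_quadratic_form_ge => //; exact: Hmx_sym.
case: cond => [[l l0 lP]|[psd [k k0 mupk] orth [l l0 infl]]].
  exists l => // x /lP[pdH lH]; split=> [a Ha _|u uH].
    exact/(le_trans lH)/lambda_min_le/Ha/posdefmx_possemidef.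
  have [->|/pdH] := eqVneq u 0; first by rewrite /dot trmx0 mulmx0 mxE.
  by rewrite uH mul0mx mxE ltxx.
exists l => // x x0; split=> [a Ha a0|u uH]; last first.
  by rewrite /dot orth ?mxE//; apply/eigenspaceP; rewrite uH scale0r.
have H0 : eigenvalue (Hmx f x) 0.
  rewrite eigenvalue_root_char; apply: contraLR k0 => /mupNroot.
  by rewrite mupk => ->.
apply: le_trans (lambda2_le (psd x x0) H0 Ha a0).
rewrite -infl; apply: ge_inf; last by exists x.
apply: contrapT => nlb; move: l0; rewrite -infl inf_out; first by rewrite ltxx.
by move=> [_]; exact: nlb.
Qed.

(** * Differentiation along curves of row vectors *)

Lemma is_derive_continuous (R : realType) (V : normedModType R) (y : R -> V)
    (t : R) v :
  is_derive t 1 y v -> {for t, continuous y}.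
Proof.
move=> dy; apply: differentiable_continuous; apply/derivable1_diffP.
exact: ex_derive.
Qed.

Section DerivativeRow.
Context {R : realType} {n : nat}.

Lemma is_derive_coord (g : R -> 'rV[R]_n) (t : R) (v : 'rV[R]_n) i :
  is_derive t 1 g v -> is_derive t 1 (fun s => g s ord0 i) (v ord0 i).
Proof.
move=> gv; have dg : derivable g t 1 by exact: ex_derive.
have /derivable_mxP/(_ ord0 i) dgi := dg.
apply: DeriveDef => //.
by rewrite -(@derive_val _ _ _ _ _ _ _ gv) derive_mx// mxE.
Qed.

Lemma is_derive_row (g : R -> 'rV[R]_n) (t : R) (v : 'rV[R]_n) :
  (forall i, is_derive t 1 (fun s => g s ord0 i) (v ord0 i)) ->
  is_derive t 1 g v.
Proof.
move=> gv; have dg : derivable g t 1.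
  by apply/derivable_mxP => i j; rewrite (ord1 i); exact: ex_derive.
apply: DeriveDef => //; apply/rowP => i.
by rewrite derive_mx// mxE; exact: derive_val.
Qed.

Lemma is_derive_sqr_dot (g : R -> 'rV[R]_n) (t : R) (v : 'rV[R]_n) :
  is_derive t 1 g v ->
  is_derive t 1 (fun s => dot (g s) (g s)) (2 * dot v (g t)).
Proof.
move=> gv.
have -> : (fun s => dot (g s) (g s)) =
    \sum_(i < n) ((fun s => g s ord0 i) * (fun s => g s ord0 i)).
  by apply/funext => s; rewrite dotE fct_sumE.
rewrite dotE mulr_sumr.
apply: is_derive_sum => i; have gvi := is_derive_coord i gv.
have := is_deriveM gvi gvi.
by rewrite /GRing.scale/= (mulrC (g t _ _)) -mulr2n
  -[_ *+ 2 in X in X -> _]mulr_natl.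
Qed.

Lemma is_derive_comp_field (f : 'rV[R]_n -> 'rV[R]_n) (y : R -> 'rV[R]_n)
    (t : R) (v : 'rV[R]_n) :
  differentiable f (y t) -> is_derive t 1 y v ->
  is_derive t 1 (f \o y) (v *m jacobian f (y t)).
Proof.
move=> df yv.
have dy : differentiable y t by apply/derivable1_diffP; exact: ex_derive.
have dfy : differentiable (f \o y) t by exact: differentiable_comp.
apply: DeriveDef; first exact/derivable1_diffP.
rewrite deriveE// diff_comp//= -deriveE// deriveEjacobian//; congr (_ *m _).
by rewrite -deriveE//; exact: derive_val.
Qed.

Lemma dot_HmxE (f : 'rV[R]_n -> 'rV[R]_n) x v :
  dot (v *m Hmx f x) v = 2 * dot (v *m - jacobian f x) v.
Proof.
rewrite /Hmx opprD mulmxDr dotDl -linearN/= [dot (v *m _^T) v]dot_mulmxl trmxK.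
by rewrite (dotC v) -mulr2n mulr_natl.
Qed.

(** The antisymmetric part of the Jacobian does not contribute to a quadratic
    form, so the derivative of the energy only sees [H]. *)
Lemma is_derive_energy (f : 'rV[R]_n -> 'rV[R]_n) (y : R -> 'rV[R]_n)
    (t c : R) :
  differentiable f (y t) -> is_derive t 1 y (c *: f (y t)) ->
  is_derive t 1 (fun s => dot (f (y s)) (f (y s)))
    (- (c * dot (f (y t) *m Hmx f (y t)) (f (y t)))).
Proof.
move=> df yv; have := is_derive_sqr_dot (is_derive_comp_field df yv).
rewrite /=; set v := f (y t); set J := jacobian f _.
have -> // : 2 * dot (c *: v *m J) v = - (c * dot (v *m Hmx f (y t)) v).
rewrite dot_HmxE -/J mulmxN dotNl -scalemxAl dotZl; ring.
Qed.

End DerivativeRow.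

Lemma nincr_segment (R : realType) (h dh : R -> R) (a b : R) : a <= b ->
  {within `[a, b], continuous h} ->
  (forall t, a < t < b -> is_derive t 1 h (dh t)) ->
  (forall t, a < t < b -> dh t <= 0) ->
  h b <= h a.
Proof.
move=> ab ch dhP dh0; rewrite -subr_le0.
move: ab; rewrite le_eqVlt => /predU1P[->|ab]; first by rewrite subrr.
have [t tab ->] := MVT ab (fun t (tab : t \in `]a, b[%R) => dhP t tab) ch.
by rewrite mulr_le0_ge0 ?dh0// subr_ge0 ltW.
Qed.

(** Solutions are constrained at nonnegative times only; the even extension
    makes them continuous on the whole line, so that the change of time is
    differentiable on both sides of [0]. *)
Lemma continuous_normr_extension (R : realType) (n : nat) (x : R -> 'rV[R]_n) :
  {within [set t : R | 0 <= t], continuous x} ->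
  continuous (fun t : R => x `|t|).
Proof.
move=> cx t; have t0 : [set t : R | 0 <= t] `|t| by exact: normr_ge0.
have cxt :
    x s @[s --> within [set t : R | 0 <= t] (nbhs (`|t| : R))] --> x `|t|.
  by rewrite (nbhs_subspace_in t0); exact: cx.
apply: (@cvg_comp R R _ (fun s : R => `|s|) x (nbhs t)
  (within [set t : R | 0 <= t] (nbhs (`|t| : R)))) cxt.
have ct : `|s| @[s --> t] --> `|t| by exact: norm_continuous.
move=> B BP; have : \forall s \near t, 0 <= `|s| -> B `|s| by exact: ct BP.
by apply: filterS => s; apply; exact: normr_ge0.
Qed.

(** The form in which differentiability is checked at the instant where two
    pieces of a solution are glued. *)
Lemma is_derive_squeezed (R : realType) (n : nat) (y : R -> 'rV[R]_n) (t : R) :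
  y t = 0 ->
  (forall e : R, 0 < e -> \forall s \near t, `|y s| <= e * `|s - t|) ->
  is_derive t 1 y 0.
Proof.
move=> yt sq.
have cy : h^-1 *: ((y \o shift t) (h *: 1) - y t) @[h --> 0^'] -->
    (0 : 'rV[R]_n).
  apply/cvgrPdist_le => e e0; have /nbhs_ballP[r /= r0 rP] := sq e e0.
  exists r => //= h; rewrite /ball_/= sub0r normrN => hr h0.
  rewrite sub0r normrN yt subr0 normrZ normfV ler_pdivrMl ?normr_gt0//.
  rewrite /shift/= /GRing.scale/= mulr1.
  have := rP (h + t); rewrite addrK mulrC; apply.
  by rewrite -ball_normE/= opprD addrCA subrr addr0 normrN.
apply: DeriveDef; first by apply/cvg_ex; exists 0.
exact/cvg_lim.
Qed.

Lemma is_derive_row_comp (R : realType) (n : nat) (x : R -> 'rV[R]_n)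
    (th : R -> R) (s a : R) (v : 'rV[R]_n) :
  is_derive (th s) 1 x v -> is_derive s 1 th a ->
  is_derive s 1 (x \o th) (a *: v).
Proof.
move=> dx dth; apply: is_derive_row => i; rewrite mxE mulrC.
exact: (is_derive1_comp (is_derive_coord i dx) dth).
Qed.

(** For the sup norm the mean value inequality follows from the scalar theorem
    applied to each coordinate. *)
Lemma row_mean_value (R : realType) (n : nat) (y : R -> 'rV[R]_n)
    (dy : R -> 'rV[R]_n) (a b e : R) : a <= b -> 0 <= e ->
  {within `[a, b], continuous y} ->
  (forall s, a < s < b -> is_derive s 1 y (dy s)) ->
  (forall s, a < s < b -> `|dy s| <= e) ->
  `|y b - y a| <= e * (b - a).
Proof.
move=> ab e0 cy dyP dye.
apply: norm_le_coord => [|i]; first by rewrite mulr_ge0// subr_ge0.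
move: ab; rewrite le_eqVlt => /predU1P[->|ab].
  by rewrite !subrr mulr0 mxE normr0.
have cyi : {within `[a, b], continuous (fun s => y s ord0 i)}.
  by move=> s; apply: cvg_coord; exact: cy.
have dyi s (sab : s \in `]a, b[%R) := is_derive_coord i (dyP s sab).
have [s sab ysE] := MVT ab dyi cyi.
rewrite !mxE ysE normrM [`|b - a|]gtr0_norm ?subr_gt0//.
rewrite ler_wpM2r ?subr_ge0 ?(ltW ab)//.
exact: le_trans (norm_entry_le _ _ _) (dye s sab).
Qed.

(** * Properness of the energy *)

Lemma enormE (R : realType) (n : nat) (x : 'rV[R]_n) :
  enorm x = Num.sqrt (dot x x).
Proof. by rewrite /enorm dotE; under eq_bigr do rewrite expr2. Qed.

Lemma norm_le_enorm (R : realType) (n : nat) (x : 'rV[R]_n) : `|x| <= enorm x.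
Proof.
rewrite enormE -[leLHS]ger0_norm// -sqrtr_sqr ler_sqrt ?dot_ge0//.
exact: sqr_norm_le_dot.
Qed.

Lemma continuous_enorm (R : realType) (n : nat) :
  continuous (@enorm R n).
Proof.
move=> x; rewrite (_ : @enorm R n = fun z => Num.sqrt (dot z z)); last first.
  by apply/funext => z; rewrite enormE.
apply: (@continuous_comp _ _ _ (fun z : 'rV[R]_n => dot z z) Num.sqrt).
  by apply: (@cvg_dot _ _ (nbhs x)); exact: cvg_id.
exact: sqrt_continuous.
Qed.

(** Outside a large ball coercivity keeps the energy above [1]; on the compact
    shell between radius [e] and that ball the energy attains a minimum, which
    is positive because [f] vanishes at the origin only. *)
Lemma energy_proper (R : realType) (n : nat) (f : 'rV[R]_n -> 'rV[R]_n) :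
  continuous f -> (forall x, x != 0 -> f x != 0) ->
  (forall M : R, exists r : R, forall x, r < enorm x -> M < enorm (f x)) ->
  forall e : R, 0 < e -> exists2 c : R, 0 < c &
    forall x, dot (f x) (f x) < c -> enorm x < e.
Proof.
move=> cf fN0 coer e e0.
have [r rP] := coer 1.
have far x : r < enorm x -> 1 < dot (f x) (f x).
  move=> /rP; apply: contraLR; rewrite -!leNgt enormE => /ler_wsqrtr.
  by rewrite sqrtr1.
pose K := [set x : 'rV[R]_n | e <= enorm x] `&` [set x | enorm x <= r].
have [K0|/set0P/negP/negPn/eqP K0] := pselect (K !=set0); last first.
  exists 1 => // x Wx; rewrite ltNge; apply/negP => ex.
  have [xr|/far] := leP (enorm x) r; last by rewrite ltNge (ltW Wx).
  by have : K x by []; rewrite K0.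
have compactK : compact K.
  apply: bounded_closed_compact.
    exists r; split; first exact: num_real.
    move=> M rM x [_ /= xr]; rewrite (le_trans (norm_le_enorm x))//.
    by rewrite (le_trans xr)// ltW.
  apply: closedI.
    apply: (@preimage_closed _ _ (@enorm R n) [set z | e <= z]);
      last exact: closed_ge.
    by move=> x _; exact: continuous_enorm.
  apply: (@preimage_closed _ _ (@enorm R n) [set z | z <= r]);
      last exact: closed_le.
  by move=> x _; exact: continuous_enorm.
have cW : {within K, continuous (fun x => dot (f x) (f x))}.
  apply: continuous_subspaceT => x.
  by apply: (@cvg_dot _ _ (nbhs x)); exact: cf.
have [x0 x0K minW] := EVT_min_rV K0 compactK cW.
move: x0K; rewrite inE => -[/= ex0 _].
have x00 : x0 != 0.
  apply: contraTneq e0 => x00; move: ex0.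
  by rewrite x00 enormE /dot mul0mx mxE sqrtr0 -leNgt.
exists (Num.min 1 (dot (f x0) (f x0))).
  by rewrite lt_min ltr01 dot_gt0// fN0.
move=> x; rewrite lt_min => /andP[Wx1 Wx]; rewrite ltNge; apply/negP => ex.
have [xr|/far] := leP (enorm x) r; last by rewrite ltNge (ltW Wx1).
by move: Wx; rewrite ltNge minW// inE.
Qed.

(** * Descent of the energy along rescaled trajectories *)

Section Descent.
Context {R : realType} {n : nat}.
Variables (f : 'rV[R]_n -> 'rV[R]_n) (l : R).
Hypothesis df : forall x, differentiable f x.
Hypothesis l0 : 0 < l.
Hypothesis diss :
  forall x, l * dot (f x) (f x) <= dot (f x *m Hmx f x) (f x).

Let W x := dot (f x) (f x).

Let cf : continuous f.
Proof. by move=> x; exact: differentiable_continuous. Qed.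

Lemma cvg_energy (T : Type) (F : set_system T) (FF : Filter F)
    (y : T -> 'rV[R]_n) (z : 'rV[R]_n) :
  y @ F --> z -> dot (f (y t)) (f (y t)) @[t --> F] --> dot (f z) (f z).
Proof.
move=> yz; have fyz : (f \o y) @ F --> f z.
  by apply: (@cvg_comp _ _ _ y f F (nbhs z) (nbhs (f z)) yz); exact: cf.
exact: cvg_dot.
Qed.

Section Solution.
Variables (c : 'rV[R]_n -> R) (y : R -> 'rV[R]_n).
Hypothesis c0 : forall x, 0 <= c x.
Hypothesis ysol : is_solution (fun x => c x *: f x) y.

Lemma energy_derive (t : R) : 0 < t -> is_derive t 1 (W \o y)
  (- (c (y t) * dot (f (y t) *m Hmx f (y t)) (f (y t)))).
Proof. by move=> t0; apply: is_derive_energy => //; exact: ysol.2. Qed.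

Lemma energy_continuous (a b : R) : 0 <= a ->
  {within `[a, b], continuous (W \o y)}.
Proof.
move=> a0.
have cW : {within [set t : R | 0 <= t], continuous (W \o y)}.
  by move=> t; apply: cvg_energy; exact: ysol.1.
apply: continuous_subspaceW cW => t /=; rewrite in_itv/= => /andP[at_ _].
exact: le_trans at_.
Qed.

Lemma energy_nincr (s t : R) : 0 <= s -> s <= t -> W (y t) <= W (y s).
Proof.
move=> s0 st; apply: (nincr_segment st (energy_continuous s0)) => r /andP[sr _].
  exact/energy_derive/(le_lt_trans s0).
rewrite oppr_le0 mulr_ge0//; apply: le_trans (diss _).
by rewrite mulr_ge0 ?(ltW l0)// dot_ge0.
Qed.

(** A comparison of [W^g / g] with a clock [th]: multiplying
    [W(y)' <= - c(y) l W(y)] by [W^(g-1)] gives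
    [(W^g / g)' <= - l c(y) W^g <= - l th'].  The sign of [g] is free, which
    serves both regimes of the fixed-time estimate with [th(t) = t]; taking
    for [th] a rescaled time bounds that time by the initial energy. *)
Lemma power_energy_decrease (g s t : R) (th dth : R -> R) : g != 0 ->
  (forall r : R, 0 <= r -> {for r, continuous th}) ->
  (forall r : R, 0 < r -> is_derive r 1 th (dth r)) ->
  (forall r : R, 0 < r -> 0 < W (y r) -> dth r <= c (y r) * W (y r) `^ g) ->
  0 <= s -> s <= t -> 0 < W (y t) ->
  g^-1 * W (y t) `^ g + l * th t <= g^-1 * W (y s) `^ g + l * th s.
Proof.
move=> g0 cth dthP dthle s0 st Wt.
have Wpos r : s <= r -> r <= t -> 0 < W (y r).
  by move=> sr rt; apply: lt_le_trans Wt (energy_nincr (le_trans s0 sr) rt).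
pose h r := g^-1 * W (y r) `^ g + l * th r.
pose dh r := W (y r) `^ (g - 1) *
  - (c (y r) * dot (f (y r) *m Hmx f (y r)) (f (y r))) + l * dth r.
apply: (@nincr_segment _ h dh s t st) => [|r /andP[sr rt]|r /andP[sr rt]].
- rewrite continuous_subspace_in => r; rewrite inE/= in_itv/= => /andP[sr rt].
  apply: cvgD; last first.
    apply: cvgM; first exact: cvg_cst.
    apply: continuous_subspaceT_for; first by rewrite /= in_itv/= sr.
    exact/cth/(le_trans s0).
  apply: cvgM; first exact: cvg_cst.
  have cP : {for W (y r), continuous (fun w : R => w `^ g)}.
    apply: differentiable_continuous; apply/derivable1_diffP.
    by apply: ex_derive; apply: is_derive1_powR; exact: Wpos.
  apply: (@cvg_comp _ _ _ (W \o y) (fun w => w `^ g) _ (nbhs (W (y r)))) cP.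
  exact: (energy_continuous s0).
- have r0 := le_lt_trans s0 sr.
  have Wr := Wpos r (ltW sr) (ltW rt).
  have dP : is_derive ((W \o y) r) 1 (fun w => w `^ g) (g * W (y r) `^ (g - 1)).
    exact: is_derive1_powR.
  have dPW := is_derive1_comp dP (energy_derive r0).
  have dth' := dthP r r0.
  apply: (is_derive_eq (is_deriveD (is_deriveZ g^-1 dPW) (is_deriveZ l dth'))).
  by rewrite /dh /GRing.scale/= -!mulrA mulKf.
- have r0 := le_lt_trans s0 sr.
  have Wr := Wpos r (ltW sr) (ltW rt).
  rewrite /dh mulrN addrC subr_le0.
  apply: (@le_trans _ _ (l * (c (y r) * W (y r) `^ g))).
    by rewrite ler_pM2l// dthle.
  have -> : W (y r) `^ g = W (y r) `^ (g - 1) * W (y r).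
    rewrite powRB ?(gt_eqF Wr) ?implybT// powRr1 ?ltW// divfK//.
    by rewrite gt_eqF.
  have -> : l * (c (y r) * (W (y r) `^ (g - 1) * W (y r))) =
      W (y r) `^ (g - 1) * (c (y r) * (l * W (y r))) by ring.
  by rewrite ler_wpM2l ?powR_ge0// ler_wpM2l ?c0 ?diss.
Qed.

End Solution.

Lemma is_solution_scale1 (y : R -> 'rV[R]_n) :
  is_solution f y -> is_solution (fun x => 1 *: f x) y.
Proof. by under eq_fun do rewrite scale1r. Qed.

(** The rate [k] is free: [k = l] yields the decay of the energy, and a large
    [k] yields its positivity. *)
Lemma exp_energy_derive (y : R -> 'rV[R]_n) (k t : R) :
  is_solution f y -> 0 < t ->
  is_derive t 1 (fun r => W (y r) * expR (k * r))
    ((k * W (y t) - dot (f (y t) *m Hmx f (y t)) (f (y t))) * expR (k * t)).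
Proof.
move=> /is_solution_scale1 ysol t0; have dW := energy_derive ysol t0.
have dk : is_derive t 1 (fun r : R => k * r) k.
  have := is_deriveZ k (is_derive_id t (1 : R)).
  by rewrite /GRing.scale/= mulr1.
have dE := is_derive1_comp (is_derive_expR (k * t)) dk.
apply: (is_derive_eq (is_deriveM dW dE)).
rewrite /GRing.scale/= mul1r mulrBl mulrN [_ * dot _ _]mulrC; congr (_ - _).
by rewrite mulrA mulrC mulrA.
Qed.

Lemma exp_energy_continuous (y : R -> 'rV[R]_n) (k t : R) :
  is_solution f y ->
  {within `[0, t], continuous (fun r => W (y r) * expR (k * r))}.
Proof.
move=> /is_solution_scale1 ysol r.
apply: cvgM; first exact: (energy_continuous ysol (lexx 0)).
apply: continuous_subspaceT => {}r.
apply: continuous_comp; last exact: continuous_expR.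
by apply: cvgM; [exact: cvg_cst|exact: cvg_id].
Qed.

Hypothesis proper : forall e : R, 0 < e -> exists2 d : R, 0 < d &
  forall x, dot (f x) (f x) < d -> enorm x < e.
Hypothesis f0 : f 0 = 0.

(** The energy of the initial state bounds the energy for ever, and it is small
    near the origin by continuity of [f]. *)
Lemma descent_lyapunov_stable (c : 'rV[R]_n -> R) : (forall x, 0 <= c x) ->
  lyapunov_stable (fun x => c x *: f x).
Proof.
move=> c0 e e0; have [d d0 dP] := proper e0.
have W0 : W x @[x --> (0 : 'rV[R]_n)] --> 0.
  have W00 : dot (f 0) (f 0) = 0 by rewrite f0 /dot mul0mx mxE.
  have := @cvg_energy _ (nbhs (0 : 'rV[R]_n)) _ id 0.
  by rewrite W00; apply; exact: cvg_id.
have /nbhs_ballP[r /= r0 rP] : \forall x \near (0 : 'rV[R]_n), W x < d.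
  by apply: cvgr_lt W0 _ _.
exists r => // y ysol yr t t0; apply: dP.
apply: le_lt_trans (energy_nincr c0 ysol (lexx 0) t0) _.
apply: rP; rewrite -ball_normE/= sub0r normrN.
exact: le_lt_trans (norm_le_enorm _) yr.
Qed.

(** The energy times [exp(l t)] does not increase, so the energy tends to [0]
    and properness carries this over to the state. *)
Lemma descent_attractive y : is_solution f y ->
  enorm (y t) @[t --> +oo] --> (0 : R).
Proof.
move=> ysol.
have decay (t : R) : 0 <= t -> W (y t) * expR (l * t) <= W (y 0).
  move=> t0.
  have := nincr_segment t0 (@exp_energy_continuous y l t ysol)
    (fun r r0t => @exp_energy_derive y l r ysol (elimT andP r0t).1).
  rewrite mulr0 expR0 mulr1; apply=> r _.
  by rewrite pmulr_lle0 ?expR_gt0// subr_le0; exact: diss.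
apply/cvgrPdist_lt => e e0; have [d d0 dP] := proper e0.
exists (W (y 0) / (d * l)); split; first exact: num_real.
move=> t Wt; rewrite sub0r normrN ger0_norm ?sqrtr_ge0//.
have t0 : 0 <= t.
  by apply: le_trans (ltW Wt); rewrite divr_ge0 ?dot_ge0// mulr_ge0// ltW.
apply: dP; rewrite -(ltr_pM2r (expR_gt0 (l * t))).
apply: le_lt_trans (decay t t0) _.
apply: lt_le_trans (_ : d * (1 + l * t) <= _); last first.
  by rewrite ler_pM2l// expR_ge1Dx.
move: Wt; rewrite ltr_pdivrMr ?mulr_gt0// => Wt.
by apply: lt_trans Wt _; rewrite mulrDr mulr1 mulrA [_ * t]mulrC ltrDr.
Qed.

End Descent.

(** * Trajectories avoid the origin *)

(** Backward uniqueness at the equilibrium.  On the compact interval from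
    [0] to [t] the Jacobian is bounded along the trajectory, so [W' >= - K W] for some [K]
    and the energy stays above [W(x(0)) exp(- K t) > 0]. *)
Lemma never_reaches_zero (R : realType) (n : nat) (f : 'rV[R]_n -> 'rV[R]_n)
    (x : R -> 'rV[R]_n) :
  C1 f -> f 0 = 0 -> (forall z, z != 0 -> f z != 0) ->
  is_solution f x -> x 0 != 0 -> forall t, 0 <= t -> x t != 0.
Proof.
move=> [df cJ] f0 fN0 xsol x00 t t0; apply/negP => /eqP xt0.
have cJx : {within `[0, t], continuous (fun s => `|jacobian f (x s)|)}.
  have : {within [set s : R | 0 <= s],
      continuous (fun s => `|jacobian f (x s)|)}.
    move=> s; apply: (@cvg_comp _ _ _ (fun s => jacobian f (x s)) Num.norm _
      (nbhs (jacobian f (x s)))); last exact: norm_continuous.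
    apply: (@cvg_comp _ _ _ x (jacobian f) _ (nbhs (x s))); last exact: cJ.
    exact: xsol.1.
  by apply: continuous_subspaceW => s /=; rewrite in_itv/= => /andP[].
have [m _ maxJ] := EVT_max t0 cJx.
pose M := `|jacobian f (x m)|.
have {}maxJ s : s \in `[0, t]%R -> `|jacobian f (x s)| <= M by move=> /maxJ.
pose K := 2 * (n%:R ^+ 2 * M).
pose E r := dot (f (x r)) (f (x r)) * expR (K * r).
have dE (r : R) (r0t : 0 < r < t) :=
  exp_energy_derive df K xsol (elimT andP r0t).1.
have cE : {within `[0, t], continuous E} by exact: exp_energy_continuous.
have dNE (r : R) (r0t : 0 < r < t) := is_deriveN (dE r r0t).
have : - E t <= - E 0.
  apply: (nincr_segment t0 _ dNE) => [r|r /andP[r0 rt]].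
    by apply: cvgN; exact: cE.
  rewrite oppr_le0 mulr_ge0 ?expR_ge0// subr_ge0.
  rewrite dot_HmxE /K -[leRHS]mulrA ler_pM2l; last exact: ltr0n.
  apply: le_trans (quadratic_form_le _ _) _; rewrite normrN.
  apply: ler_wpM2r; first exact: dot_ge0.
  apply: ler_wpM2l; first exact/exprn_ge0/ler0n.
  by apply: maxJ; rewrite in_itv/= (ltW r0) (ltW rt).
have Et0 : E t = 0 by rewrite /E xt0 f0 /dot mul0mx mxE mul0r.
rewrite lerN2 Et0 /E mulr0 expR0 mulr1 leNgt dot_gt0//.
exact: fN0.
Qed.

(** * Change of time *)

(** The origin of the integral is placed at [-1] so that the primitive is
    differentiable on a neighbourhood of the half-line of nonnegative times. *)
Lemma exists_primitive (R : realType) (k : R -> R) : continuous k ->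
  exists F : R -> R, forall t : R, -1 < t -> is_derive t 1 F (k t).
Proof.
move=> ck; pose F x := \int[@lebesgue_measure R]_(t in `[-1, x]) k t.
exists F => t t1.
have tt : t < t + 1 by rewrite ltrDl.
have ik : (@lebesgue_measure R).-integrable `[-1, t + 1] (EFin \o k).
  apply: continuous_compact_integrable; first exact: segment_compact.
  exact: continuous_subspaceT.
have [dF FE] := continuous_FTC1_closed tt ik t1 (ck t).
split; first exact: dF.
by rewrite -derive1E; exact: FE.
Qed.

(** The rescaled time [s] is a primitive of [k], the inverse of the factor by
    which [g] speeds [f] up.  It is strictly increasing and bounded, so it maps
    the nonnegative half-line onto the interval from [0] to [S], excluded,
    where [S] is the supremum of its values, and [x] composed with the inverse of [s] solves [y' = g(y)] there.
    At [S] the curve reaches the equilibrium and is continued by [0].  Its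
    derivative at [S] is [0]: the velocities [g(y)] tend to [0] as [y] does, and
    the mean value inequality bounds [|y(r)|] by [e (S - r)] near [S]. *)
Lemma time_change (R : realType) (n : nat) (f g : 'rV[R]_n -> 'rV[R]_n)
    (x : R -> 'rV[R]_n) (k : R -> R) (B : R) :
  is_solution f x -> x t @[t --> +oo] --> (0 : 'rV[R]_n) ->
  g 0 = 0 -> g z @[z --> (0 : 'rV[R]_n)] --> (0 : 'rV[R]_n) ->
  continuous k -> (forall t, 0 < k t) ->
  (forall t, 0 < t -> k t *: g (x t) = f (x t)) ->
  (forall s : R -> R, (forall t : R, -1 < t -> is_derive t 1 s (k t)) ->
    forall t, 0 <= t -> s t <= s 0 + B) ->
  exists y, is_solution g y /\ y 0 = x 0.
Proof.
move=> xsol xlim g0 glim ck k0 kg bounded.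
have [s0 ds0] := exists_primitive ck.
pose s t := s0 t - s0 0.
have s00 : s 0 = 0 by rewrite /s subrr.
have ds (t : R) : -1 < t -> is_derive t 1 s (k t).
  move=> t1; have := is_deriveB (ds0 t t1) (is_derive_cst (s0 0) t (1 : R)).
  by rewrite subr0.
have cs (t : R) : -1 < t -> {for t, continuous s}.
  by move=> /ds/is_derive_continuous.
have sB t : 0 <= t -> s t <= B.
  by move=> t0; have := bounded s ds t t0; rewrite s00 add0r.
have s_lt a b : -1 < a -> a < b -> s a < s b.
  move=> a1 ab; rewrite -subr_gt0.
  have dab r (rab : r \in `]a, b[%R) : is_derive r 1 s (k r).
    by apply: ds; move: rab; rewrite in_itv/= => /andP[+ _]; exact: lt_trans.
  have cab : {within `[a, b], continuous s}.
    apply: continuous_in_subspaceT => r; rewrite inE/= in_itv/= => /andP[ar _].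
    exact/cs/(lt_le_trans a1).
  by have [r _ ->] := MVT ab dab cab; rewrite mulr_gt0// subr_gt0.
have s_ge0 t : 0 <= t -> 0 <= s t.
  rewrite le_eqVlt => /predU1P[<-|t0]; first by rewrite s00.
  by rewrite -[leLHS]s00 ltW// s_lt ?ltrN10.
have s_inj a b : -1 < a -> -1 < b -> s a = s b -> a = b.
  move=> a1 b1 sab; have [ab|ba|//] := ltgtP a b.
  - by have := s_lt _ _ a1 ab; rewrite sab ltxx.
  - by have := s_lt _ _ b1 ba; rewrite sab ltxx.
(* The inverse of [s], with a default value off its range. *)
pose th r := xget 0 [set t | -1 < t /\ s t = r].
have thK t : -1 < t -> th (s t) = t.
  move=> t1; rewrite /th; case: xgetP => [u _ [u1 su]|/(_ t)[]//].
  exact: s_inj.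
have dth (t : R) : -1 < t -> is_derive (s t) 1 th (k t)^-1.
  move=> t1; apply: is_derive_inverse; last by rewrite gt_eqF.
  - by near=> r; apply: thK; near: r; exact: lt_nbhsr.
  - by near=> r; apply: cs; near: r; exact: lt_nbhsr.
  - exact: ds.
have N10 (t : R) : 0 <= t -> -1 < t by apply: lt_le_trans; rewrite ltrN10.
pose A := s @` [set t | 0 <= t].
have supA : has_sup A.
  split; first by exists (s 0); exists 0 => //=.
  by exists B => _ [t t0 <-]; exact: sB.
pose S := sup A.
have s_ltS t : 0 <= t -> s t < S.
  move=> t0; apply: lt_le_trans (_ : s (t + 1) <= S).
    by apply: s_lt; rewrite ?N10// ltrDl.
  apply: sup_upper_bound => //; exists (t + 1) => //=.
  by rewrite addr_ge0.
have hit r : 0 <= r -> r < S -> exists2 t, 0 <= t & s t = r.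
  move=> r0 rS; have e0 : 0 < S - r by rewrite subr_gt0.
  have [_ [t /= t0 <-]] := sup_adherent e0 supA.
  rewrite opprB addrC subrK => rst.
  have cst' : {within `[0, t], continuous s}.
    apply: continuous_in_subspaceT => u; rewrite inE/= in_itv/= => /andP[u0 _].
    exact/cs/N10.
  have st0 : s 0 <= s t by rewrite s00 (le_trans r0)// ltW.
  have [|u] := IVT t0 cst' (v := r).
    by rewrite min_l// max_r// s00 r0 ltW.
  by rewrite in_itv/= => /andP[u0 _] su; exists u.
have S0 : 0 < S by rewrite -s00 s_ltS.
pose X (t : R) := x `|t|.
have cX : continuous X := continuous_normr_extension xsol.1.
pose y r := if r < S then X (th r) else 0.
have yE t : 0 <= t -> y (s t) = x t.
  by move=> t0; rewrite /y s_ltS// thK ?N10// /X ger0_norm.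
have yS r : S <= r -> y r = 0 by move=> Sr; rewrite /y ltNge Sr.
have y_near r : r < S -> \forall u \near r, X (th u) = y u.
  by move=> rS; near=> u; rewrite /y ifT//; near: u; exact: lt_nbhsl.
have cy (t : R) : 0 <= t -> {for s t, continuous y}.
  move=> t0; have ct : {for s t, continuous (X \o th)}.
    apply: continuous_comp.
      exact: is_derive_continuous (dth t (N10 t t0)).
    exact: cX.
  have yst : X (th (s t)) = y (s t) := nbhs_singleton (y_near _ (s_ltS t t0)).
  have : y u @[u --> s t] --> X (th (s t)).
    by apply: cvg_trans ct; apply: near_eq_cvg; exact: y_near (s_ltS t t0).
  by rewrite yst.
have dy (t : R) : 0 < t -> is_derive (s t) 1 y (g (y (s t))).
  move=> t0; have t1 : -1 < t by rewrite N10// ltW.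
  apply: near_eq_is_derive (y_near _ (s_ltS t (ltW t0))) _.
  have dX : is_derive (th (s t)) 1 X (f (x t)).
    rewrite thK//; apply: near_eq_is_derive (xsol.2 t t0).
    by near=> u; rewrite /X gtr0_norm//; near: u; exact: lt_nbhsr.
  have := is_derive_row_comp dX (dth t t1).
  by rewrite yE ?(ltW t0)// -kg// scalerA mulVf ?gt_eqF// scale1r.
have small e : 0 < e -> exists2 r, 0 <= r < S & forall u, r < u -> `|y u| < e.
  move=> e0; have [T [_ TP]] := (cvgrPdist_lt _ _).1 xlim e e0.
  have T0 : 0 <= Num.max T 0 by rewrite le_max lexx orbT.
  exists (s (Num.max T 0)).
    by rewrite s_ltS// s_ge0.
  move=> u ru; have [uS|Su] := ltP u S; last by rewrite yS// normr0.
  have u0 : 0 <= u by apply: le_trans (ltW ru); exact: s_ge0.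
  have [t t0 st] := hit u u0 uS; rewrite -st yE//.
  have := TP t; rewrite sub0r normrN; apply.
  rewrite ltNge; apply/negP => tT; move: ru; rewrite -st ltNge => /negP; apply.
  have : t <= Num.max T 0 by rewrite le_max tT.
  by rewrite le_eqVlt => /predU1P[->//|tT']; rewrite ltW// s_lt ?N10.
have cyS : {for S, continuous y}.
  suff : y u @[u --> S] --> (0 : 'rV[R]_n) by rewrite -(yS S (lexx S)).
  apply/cvgrPdist_lt => e e0.
  have [r /andP[_ rS] rP] := small e e0.
  by near=> u; rewrite sub0r normrN rP//; near: u; exact: lt_nbhsr.
have dyS : is_derive S 1 y 0.
  apply: is_derive_squeezed => [|e e0]; first exact: yS.
  have /nbhs_ballP[d /= d0 dP] :
      \forall z \near (0 : 'rV[R]_n), `|0 - g z| <= e.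
    exact: (cvgrPdist_le _ _).1 glim e e0.
  have [r /andP[r0 rS] rP] := small d d0.
  near=> u.
  have ru : r < u by near: u; exact: lt_nbhsr.
  have [uS|Su] := ltP u S; last by rewrite yS// normr0 mulr_ge0// ltW.
  rewrite distrC gtr0_norm ?subr_gt0// -normrN -[- y u]add0r -(yS S (lexx S)).
  have u0 := le_lt_trans r0 ru.
  have inner v : u <= v -> v < S -> exists2 t, 0 < t & s t = v.
    move=> uv vS; have v0 := lt_le_trans u0 uv.
    have [t t0 st] := hit v (ltW v0) vS; exists t => //.
    rewrite lt_def t0 andbT; apply: contraTneq v0 => t00.
    by rewrite -st t00 s00 ltxx.
  apply: (row_mean_value (dy := g \o y)) (ltW uS) (ltW e0) _ _ _.
  - apply: continuous_in_subspaceT => v; rewrite inE/= in_itv/= => /andP[uv].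
    rewrite le_eqVlt => /predU1P[->//|vS].
    by have [t t0 <-] := inner v uv vS; exact: cy (ltW t0).
  - move=> v /andP[uv vS]; have [t t0 <-] := inner v (ltW uv) vS.
    exact: dy.
  - move=> v /andP[uv vS] /=; rewrite -normrN -[- g _]add0r.
    apply: dP; rewrite -ball_normE/= sub0r normrN.
    exact/rP/(lt_trans ru).
exists y; split; last by rewrite -[in LHS]s00 yE.
split=> [|r r0].
  apply: continuous_in_subspaceT => r; rewrite inE/= => r0.
  have [rS|] := ltP r S; first by have [t t0 <-] := hit r r0 rS; exact: cy.
  rewrite le_eqVlt => /predU1P[<-//|Sr].
  apply: (@is_derive_continuous _ _ _ _ 0).
  apply: near_eq_is_derive (is_derive_cst 0 r (1 : R)).
  by near=> u; rewrite yS//; apply: ltW; near: u; exact: lt_nbhsr.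
have [rS|] := ltP r S.
  have [t t0 st] := hit r (ltW r0) rS; rewrite -st; apply: dy.
  rewrite lt_def t0 andbT; apply: contraTneq r0 => t00.
  by rewrite -st t00 s00 ltxx.
move=> Sr; rewrite yS// g0; move: Sr; rewrite le_eqVlt => /predU1P[<-//|Sr].
apply: near_eq_is_derive (is_derive_cst 0 r (1 : R)).
by near=> u; rewrite yS//; apply: ltW; near: u; exact: lt_nbhsr.
Unshelve. all: by end_near. Qed.

(** * The rescaled field *)

(** Set to [0] at the origin, so that the rescaled field is [gain] times [f]
    everywhere. *)
Definition gain (R : realType) (n : nat) (p q : R) (f : 'rV[R]_n -> 'rV[R]_n)
    (x : 'rV[R]_n) : R :=
  if x == 0 then 0 else (enorm (f x) `^ p)^-1 + (enorm (f x) `^ q)^-1.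

Section Gain.
Context {R : realType} {n : nat}.
Variables (p q : R) (f : 'rV[R]_n -> 'rV[R]_n).

Let W x := dot (f x) (f x).

Lemma fxts_fieldE : fxts_field p q f = fun x => gain p q f x *: f x.
Proof.
by apply/funext => x; rewrite /fxts_field /gain; case: eqP; rewrite ?scale0r.
Qed.

Lemma gain_ge0 x : 0 <= gain p q f x.
Proof.
by rewrite /gain; case: eqP => // _; rewrite addr_ge0 ?invr_ge0 ?powR_ge0.
Qed.

Lemma enorm_powR (x : 'rV[R]_n) r : enorm x `^ r = dot x x `^ (r / 2).
Proof. by rewrite enormE mulrC powRrM powR12_sqrt// dot_ge0. Qed.

(** Each of the two summands of the gain cancels one power of the energy. *)
Lemma gain_energy x r : x != 0 -> 0 < W x -> r = p \/ r = q ->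
  1 <= gain p q f x * W x `^ (r / 2).
Proof.
move=> x0 Wx; rewrite /gain (negPf x0) !enorm_powR -/(W x) mulrDl => -[->|->].
  rewrite mulVf ?gt_eqF ?powR_gt0// lerDl.
  by rewrite mulr_ge0 ?invr_ge0 ?powR_ge0.
rewrite [X in _ + X]mulVf ?gt_eqF ?powR_gt0// lerDr.
by rewrite mulr_ge0 ?invr_ge0 ?powR_ge0.
Qed.

(** For [u = |f(z)| < 1] the second summand of the gain is dominated by the
    first one, so the field has norm at most [2 u^(1-p)]. *)
Lemma fxts_field_cvg0 : continuous f -> f 0 = 0 -> p < 1 -> 0 < p -> q < 0 ->
  fxts_field p q f z @[z --> (0 : 'rV[R]_n)] --> (0 : 'rV[R]_n).
Proof.
move=> cf f0 p1 p0 q0.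
apply/(@cvgrPdist_le _ _ _ (nbhs (0 : 'rV[R]_n))) => e e0.
have cu : enorm (f z) @[z --> (0 : 'rV[R]_n)] --> (0 : R).
  have e00 : enorm (f 0) = 0 by rewrite f0 enormE /dot mul0mx mxE sqrtr0.
  have : enorm (f z) @[z --> (0 : 'rV[R]_n)] --> enorm (f 0).
    apply: (@continuous_comp _ _ _ f (@enorm R n)); first exact: cf.
    exact: continuous_enorm.
  by rewrite e00.
have p1' : 0 < 1 - p by rewrite subr_gt0.
(* [u < a] amounts to [2 u^(1-p) < e]. *)
pose a := (e / 2) `^ (1 - p)^-1.
have a0 : 0 < a by rewrite powR_gt0// divr_gt0.
near=> z.
rewrite sub0r normrN fxts_fieldE.
have [->|z0] := eqVneq z 0; first by rewrite f0 scaler0 normr0 ltW.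
rewrite normrZ ger0_norm ?gain_ge0//.
have ua : enorm (f z) < a by near: z; exact: cvgr_lt cu _ a0.
have u1 : enorm (f z) < 1 by near: z; exact: cvgr_lt cu _ ltr01.
have : `|f z| <= enorm (f z) := norm_le_enorm _.
move: ua u1; rewrite /gain (negPf z0); set u := enorm (f z) => ua u1 fu.
have u0 : 0 <= u by exact: sqrtr_ge0.
apply: (@le_trans _ _ (((u `^ p)^-1 + (u `^ q)^-1) * u)).
  by rewrite ler_wpM2l// addr_ge0// invr_ge0 powR_ge0.
move: u0; rewrite le_eqVlt => /predU1P[<-|u0]; first by rewrite mulr0 ltW.
have uu : 0 < u <= 1 by rewrite u0 ltW.
have -> : e = e / 2 + e / 2 by rewrite -splitr.
have upe : u `^ (1 - p) <= e / 2.
  have -> : e / 2 = a `^ (1 - p).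
    by rewrite -powRrM mulVf ?gt_eqF// powRr1// divr_ge0// ltW.
  by apply: ge0_ler_powR; rewrite ?nnegrE ?ltW.
rewrite mulrDl; apply: lerD.
  apply: le_trans upe; rewrite powRB ?(gt_eqF u0) ?implybT//.
  by rewrite powRr1 ?(ltW u0)// mulrC.
apply: le_trans upe; rewrite mulrC -powRN -[X in X * _]powRr1 ?(ltW u0)//.
rewrite -powRD ?(gt_eqF u0) ?implybT//.
by apply: ger_powR => //; rewrite lerD2l lerN2 ltW// (lt_trans q0).
Unshelve. all: by end_near. Qed.

End Gain.

Section FixedTime.
Context {R : realType} {n : nat}.
Variables (p q l : R) (f : 'rV[R]_n -> 'rV[R]_n).
Hypothesis hC1 : C1 f.
Hypothesis f0 : f 0 = 0.
Hypothesis fN0 : forall x, x != 0 -> f x != 0.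
Hypothesis p0 : 0 < p.
Hypothesis q0 : q < 0.
Hypothesis l0 : 0 < l.
Hypothesis diss :
  forall x, l * dot (f x) (f x) <= dot (f x *m Hmx f x) (f x).

Let W x := dot (f x) (f x).

(** [2/(-q l) + 2/(p l)]: the time to bring any energy down to [1], and the time
    to bring the energy from [1] to [0]. *)
Definition settling_bound : R := (- (q / 2) * l)^-1 + (p / 2 * l)^-1.

Let df : forall x, differentiable f x := hC1.1.

Lemma energy_gt0_neq0 x : 0 < W x -> x != 0.
Proof. by apply: contraTneq => ->; rewrite /W f0 /dot mul0mx mxE ltxx. Qed.

(** If the energy were still positive at the settling bound, it would have been
    positive before.  During the first phase [(2/q) W^(q/2)] starts from a
    negative value and loses [2/(-q)], so it ends at most at [2/q], which means
    [W <= 1]; during the second phase [(2/p) W^(p/2)] starts from at most [2/p]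
    and loses [2/p], which contradicts positivity. *)
Lemma settles y : is_solution (fxts_field p q f) y -> y settling_bound = 0.
Proof.
rewrite fxts_fieldE => ysol.
pose t1 := (- (q / 2) * l)^-1; pose t2 := (p / 2 * l)^-1.
have b0 : 0 < - (q / 2) by rewrite oppr_gt0 pmulr_llt0// invr_gt0.
have a0 : 0 < p / 2 by rewrite divr_gt0.
have t10 : 0 < t1 by rewrite invr_gt0 mulr_gt0.
have t20 : 0 < t2 by rewrite invr_gt0 mulr_gt0.
have cgain x : 0 <= gain p q f x by exact: gain_ge0.
have pN0 : p != 0 by rewrite gt_eqF.
have qN0 : q != 0 by rewrite lt_eqF.
have lN0 : l != 0 by rewrite gt_eqF.
apply: contrapT => /eqP yT0.
have WT : 0 < W (y (t1 + t2)) by apply/dot_gt0/fN0.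
have W1 : 0 < W (y t1).
  apply: lt_le_trans WT (energy_nincr df l0 diss cgain ysol (ltW t10) _).
  by rewrite lerDl ltW.
have decrease r s t : r = p \/ r = q -> r != 0 ->
    0 <= s -> s <= t -> 0 < W (y t) ->
    (r / 2)^-1 * W (y t) `^ (r / 2) + l * t <=
    (r / 2)^-1 * W (y s) `^ (r / 2) + l * s.
  move=> rpq r0 s0 st Wt.
  apply: (power_energy_decrease df l0 diss cgain ysol
    (th := id) (dth := fun=> 1)) => //.
  - by rewrite mulf_neq0// invr_neq0.
  - by move=> v _; exact: cvg_id.
  - by move=> v v0 Wv; apply: gain_energy => //; exact: energy_gt0_neq0.
have W1le : W (y t1) <= 1.
  rewrite leNgt; apply/negP => W1gt.
  have := decrease q 0 t1 (or_intror erefl) qN0 (lexx 0) (ltW t10) W1.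
  have -> : l * t1 = - (q / 2)^-1.
    by rewrite /t1; field; rewrite ?qN0 ?lN0.
  have W0q : (q / 2)^-1 * W (y 0) `^ (q / 2) <= 0.
    by rewrite mulr_le0_ge0 ?powR_ge0// invr_le0 -oppr_ge0 ltW.
  have W1q : W (y t1) `^ (q / 2) < 1.
    rewrite -[q / 2]opprK powRN invf_lt1 ?powR_gt0//.
    have := @gt0_ltr_powR _ _ b0 1 (W (y t1)); rewrite powR1; apply=> //.
      by rewrite nnegrE.
    by rewrite nnegrE ltW.
  have qi : (q / 2)^-1 < 0 by rewrite invr_lt0 -oppr_gt0.
  have : 0 < (q / 2)^-1 * (W (y t1) `^ (q / 2) - 1).
    by rewrite nmulr_rgt0// subr_lt0.
  lra.
have := decrease p t1 (t1 + t2) (or_introl erefl) pN0 (ltW t10).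
rewrite lerDl (ltW t20) => /(_ isT WT).
have -> : l * (t1 + t2) = l * t1 + (p / 2)^-1.
  by rewrite mulrDr; congr (_ + _); rewrite /t2; field; rewrite ?pN0 ?lN0.
have : W (y t1) `^ (p / 2) <= 1.
  have := @ge0_ler_powR _ _ (ltW a0) (W (y t1)) 1; rewrite powR1; apply=> //.
    by rewrite nnegrE ltW.
  by rewrite nnegrE.
have pV0 : 0 < (p / 2)^-1 by rewrite invr_gt0.
rewrite -(ler_pM2l pV0) mulr1.
have : 0 < (p / 2)^-1 * W (y (t1 + t2)) `^ (p / 2).
  by rewrite mulr_gt0// powR_gt0.
lra.
Qed.

End FixedTime.

Section Existence.
Context {R : realType} {n : nat}.
Variables (p q l : R) (f : 'rV[R]_n -> 'rV[R]_n).
Hypothesis hC1 : C1 f.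
Hypothesis f0 : f 0 = 0.
Hypothesis fN0 : forall x, x != 0 -> f x != 0.
Hypothesis p0 : 0 < p.
Hypothesis p1 : p < 1.
Hypothesis q0 : q < 0.
Hypothesis l0 : 0 < l.
Hypothesis diss :
  forall x, l * dot (f x) (f x) <= dot (f x *m Hmx f x) (f x).

Lemma gain_gt0 x : x != 0 -> 0 < gain p q f x.
Proof.
move=> x0; rewrite /gain (negPf x0).
have u0 : 0 < enorm (f x) by rewrite enormE sqrtr_gt0 dot_gt0// fN0.
by rewrite addr_gt0// invr_gt0 powR_gt0.
Qed.

Lemma gain_continuous x : x != 0 -> {for x, continuous (gain p q f)}.
Proof.
move=> x0; have u0 : 0 < enorm (f x) by rewrite enormE sqrtr_gt0 dot_gt0// fN0.
have cu : enorm (f z) @[z --> x] --> enorm (f x).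
  apply: (@continuous_comp _ _ _ f (@enorm R n)); last exact: continuous_enorm.
  exact/differentiable_continuous/(hC1.1 x).
have cpow r : (enorm (f z) `^ r)^-1 @[z --> x] --> (enorm (f x) `^ r)^-1.
  apply: (@cvgV _ _ (nbhs x)); first by rewrite gt_eqF// powR_gt0.
  have cP : {for enorm (f x), continuous (fun w : R => w `^ r)}.
    apply: differentiable_continuous; apply/derivable1_diffP.
    by apply: ex_derive; exact: is_derive1_powR.
  apply: (@cvg_comp _ _ _ (fun z => enorm (f z)) (fun w => w `^ r) _
    (nbhs (enorm (f x)))) cP.
  exact: cu.
have cg : (enorm (f z) `^ p)^-1 + (enorm (f z) `^ q)^-1 @[z --> x] -->
    gain p q f x.
  by rewrite /gain (negPf x0); apply: (@cvgD _ _ _ (nbhs x)); exact: cpow.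
apply: cvg_trans cg; apply: (@near_eq_cvg _ _ (nbhs x)).
have xpos : \forall z \near x, 0 < `|z|.
  have cn : `|z| @[z --> x] --> `|x| by exact: norm_continuous.
  by apply: (@cvgr_gt _ _ (nbhs x) _ Num.norm _ cn); rewrite normr_gt0.
apply: filterS xpos => z; rewrite normr_gt0 => zN0.
by rewrite /gain (negPf zN0).
Qed.

(** Nonzero trajectories of the rescaled system are trajectories of [f] run at
    another speed.  The total rescaled time is finite because
    [1 / gain <= W^(p/2)] and [(2/p) W^(p/2)] controls the integral of
    [W^(p/2)] along a trajectory of [f]. *)
Lemma fxts_field_forward_complete :
  forward_complete f ->
  (forall x, is_solution f x -> x t @[t --> +oo] --> (0 : 'rV[R]_n)) ->
  forward_complete (fxts_field p q f).
Proof.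
move=> fc attr x0; have [x00|x0N0] := eqVneq x0 0.
  exists (fun=> 0); split; last by rewrite x00.
  split=> [t|t _]; first exact: cvg_cst.
  rewrite /fxts_field eqxx; exact: is_derive_cst.
have [x [xsol xx0]] := fc x0.
have xN0 t : 0 <= t -> x t != 0.
  by apply: (never_reaches_zero hC1 f0 fN0 xsol); rewrite xx0.
pose k (t : R) := (gain p q f (x `|t|))^-1.
have gk t : 0 < gain p q f (x `|t|) by apply: gain_gt0; exact: xN0.
have k0 t : 0 < k t by rewrite invr_gt0.
have ck : continuous k.
  move=> t; apply: cvgV; first by rewrite gt_eqF ?gk.
  apply: (@cvg_comp _ _ _ (fun t : R => x `|t|) (gain p q f) _ (nbhs (x `|t|))).
    by apply: continuous_normr_extension; exact: xsol.1.
  by apply: gain_continuous; exact: xN0.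
have [||t t0|s ds t t0|y [ysol yx]] := @time_change _ _ f (fxts_field p q f) x k
  (l^-1 * ((p / 2)^-1 * dot (f (x 0)) (f (x 0)) `^ (p / 2))) xsol (attr x xsol)
  _ _ ck k0.
- by rewrite /fxts_field eqxx.
- by apply: fxts_field_cvg0 => // z; exact/differentiable_continuous/(hC1.1 z).
- rewrite fxts_fieldE scalerA /k (ger0_norm (ltW t0)) mulVf ?scale1r//.
  by rewrite gt_eqF// gain_gt0// xN0// ltW.
- have N10 (r : R) : 0 <= r -> -1 < r by apply: lt_le_trans; rewrite ltrN10.
  have Wt : 0 < dot (f (x t)) (f (x t)) by apply/dot_gt0/fN0/xN0.
  have := power_energy_decrease hC1.1 l0 diss (fun=> ler01)
    (is_solution_scale1 xsol) (g := p / 2) (s := 0) (t := t)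
    (th := s) (dth := k).
  have -> : (p / 2 != 0) by rewrite gt_eqF// divr_gt0.
  move=> /(_ isT) H.
  rewrite -(ler_pM2l l0) mulrDr mulVKf ?gt_eqF// addrC.
  apply: le_trans (H _ _ _ (lexx 0) t0 Wt).
  + by rewrite lerDr mulr_ge0 ?powR_ge0// invr_ge0 divr_ge0// ltW.
  + by move=> r r0; exact: is_derive_continuous (ds r (N10 r r0)).
  + by move=> r r0; apply: ds; rewrite N10// ltW.
  + move=> r r0 Wr; rewrite mul1r /k (ger0_norm (ltW r0)).
    have xr0 := xN0 r (ltW r0).
    rewrite -div1r ler_pdivrMr ?gain_gt0// mulrC.
    by apply: gain_energy => //; left.
- by exists y; rewrite yx.
Qed.

End Existence.

(** * Global asymptotic stability and fixed-time stability *)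

Theorem theorem4 (R : realType) (n : nat) (f : 'rV[R]_n -> 'rV[R]_n) (p q : R)
  (hC1 : C1 f)
  (hf0 : f 0 = 0)
  (hfN0 : forall x, x != 0 -> f x != 0)
  (hexists : forward_complete f)
  (hunique : forward_unique f)
  (hp0 : 0 < p) (hp1 : p < 1) (hq : q < 0)
  (hcoercive : forall M : R, exists r : R, forall x, r < enorm x -> M < enorm (f x))
  (hH : condition_i f \/ condition_ii f) :
  globally_asymptotically_stable f /\ fixed_time_stable (fxts_field p q f).
Proof.
have [l l0 diss] := dissipation hf0 hH.
have df := hC1.1.
have cf : continuous f by move=> x; exact: differentiable_continuous.
have proper := energy_proper cf hfN0 hcoercive.
have attractive x (xsol : is_solution f x) :=
  descent_attractive df l0 diss proper xsol.
split.
  split => //.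
  have := descent_lyapunov_stable df l0 diss proper hf0 (fun=> ler01).
  by under eq_fun do rewrite scale1r.
have complete : forward_complete (fxts_field p q f).
  apply: (fxts_field_forward_complete hC1 hf0 hfN0 hp0 hp1 hq l0 diss hexists).
  move=> x /attractive xlim; apply/cvgrPdist_lt => e e0.
  move/cvgrPdist_lt : xlim => /(_ e e0); apply: filterS => t.
  rewrite !sub0r !normrN; apply: le_lt_trans.
  by rewrite ger0_norm ?sqrtr_ge0// norm_le_enorm.
have lyapunov : lyapunov_stable (fxts_field p q f).
  rewrite fxts_fieldE.
  exact: (descent_lyapunov_stable df l0 diss proper hf0 (gain_ge0 p q f)).
have T0 : 0 <= settling_bound p q l.
  by rewrite addr_ge0// invr_ge0 mulr_ge0 ?(ltW l0)// ?oppr_ge0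
    ?divr_ge0 ?pmulr_lle0 ?invr_gt0// ltW.
have settling : settling_time (fxts_field p q f) (fun=> settling_bound p q l).
  split=> // x xsol.
  have T0' : [set t : R | 0 <= t] (settling_bound p q l) by [].
  rewrite (nbhs_subspace_in T0').
  rewrite -[X in _ --> X](settles hC1 hf0 hfN0 hp0 hq l0 diss xsol).
  exact: xsol.1.
split; first by split => //; exists (fun=> settling_bound p q l).
by exists (fun=> settling_bound p q l) => //; exists (settling_bound p q l).
Qed.
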